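(* Let $q$ be a prime power, let $r\ge2$, let $H=(V,\mathcal E,\psi_H)$ be an $r$-uniform hypergraph with $N=|V|$ vertices, let $h:=r-1$, and let $\mathcal C_H\subseteq\mathbb F_{q^h}^{|\mathcal E|}$ be the hypergraphic code of $H$. For every $A\subseteq\mathcal E$ we have $$\rho_{\mathcal C_H}(A)=f_H(A).$$ In particular, $\mathcal C_H$ is a faithful hypergraphic code with underlying hypergraph $H$, and $\dim_{\mathbb F_q}\mathcal C_H=N-\kappa(H)$.
   Context: A finite hypergraph is a triple $H=(V,\mathcal E,\psi_H)$ with finite sets $V$, $\mathcal E$ and a map $\psi_H:\mathcal E\to2^V\setminus\{\emptyset\}$ (distinct edges may have the same vertex set; $e$ is identified with $\psi_H(e)$). It is $r$-uniform if $|e|=r$ for all edges. Vertices are in the same connected component if joined by a walk $u_0,e_1,u_1,\ldots,e_\ell,u_\ell$ with $u_{i-1},u_i\in e_i$. For $A\subseteq\mathcal E$, $\kappa(A)$ is the number of components of $(V,A,\psi_H|_A)$, isolated vertices included; $\kappa(H)=\kappa(\mathcal E)$; $f_H(A):=|V|-\kappa(A)$. Hypergraphic code of $H$: for each edge fix an ordering $e=(v_{e,1},\ldots,v_{e,r})$ of its vertices, and fix an $\mathbb F_q$-linear bijection $\iota:\mathbb F_q^h\to\mathbb F_{q^h}$. For $a:V\to\mathbb F_q$ let $\Phi_H(a):=\bigl(\iota\bigl((a(v_{e,j})-a(v_{e,1}))_{2\le j\le r}\bigr)\bigr)_{e\in\mathcal E}\in\mathbb F_{q^h}^{|\mathcal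 E|}$ (coordinates indexed by $\mathcal E$), and $\mathcal C_H:=\operatorname{Im}(\Phi_H)$. For an additive code (i.e. $\mathbb F_q$-subspace) $\mathcal C\subseteq\mathbb F_{q^h}^n$ of $\mathbb F_q$-dimension $k$ and a set $A$ of coordinates, $\mathcal C(A)$ is the subspace of codewords vanishing on $A$ and $\rho_{\mathcal C}(A):=k-\dim_{\mathbb F_q}\mathcal C(A)$. $\mathcal C$ is nondegenerate (faithful) if every coordinate map $\mathcal C\to\mathbb F_{q^h}$ is nonzero (surjective). A nondegenerate additive code $\mathcal C$ is hypergraphic with underlying hypergraph $H$ if the edge set of $H$ is the coordinate set of $\mathcal C$ and $\rho_{\mathcal C}=f_H$. *)

(* Defs.v *)
From HB Require Import structures.
From mathcomp Require Import all_boot all_order all_algebra all_field.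

Set Implicit Arguments.
Unset Strict Implicit.
Unset Printing Implicit Defensive.

Import GRing.Theory.
Local Open Scope ring_scope.

Record hypergraph := Hypergraph {
  vertex : finType;
  edge : finType;
  inc : edge -> {set vertex};
  inc_neq0 : forall e, inc e != set0
}.

Definition uniform (r : nat) (H : hypergraph) : Prop :=
  forall e : edge H, #|inc e| = r.

Section Components.
Variable H : hypergraph.
Implicit Types A : {set edge H}.

(* A path for [adj A] is the vertex sequence of a walk with edges in A. *)
Definition adj A : rel (vertex H) :=
  [rel u v | [exists e in A, (u \in inc e) && (v \in inc e)]].

Lemma adj_connect_sym A : connect_sym (adj A).
Proof.
apply: sym_connect_sym => u v; apply: eq_existsb => e.
by rewrite (andbC (u \in _)).
Qed.

Definition kappa A : nat := n_comp (adj A) (vertex H).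

(* The truncated subtraction is exact: kappa counts representatives in V. *)
Definition edge_rank A : nat := (#|vertex H| - kappa A)%N.

End Components.

Section AdditiveCodes.
Variables (F : fieldType) (L : fieldExtType F) (I : finType).

(* Additive codes are F-subspaces of {ffun I -> L}. *)
Implicit Types (C : {vspace {ffun I -> L}}) (A : {set I}).

Definition coordinate (i : I) (c : {ffun I -> L}) : L := c i.

Fact coordinate_is_linear i : linear (coordinate i).
Proof. by move=> k c d; rewrite /coordinate !ffunE. Qed.

HB.instance Definition _ i :=
  GRing.isLinear.Build F {ffun I -> L} L *:%R (coordinate i) (coordinate_is_linear i).

Definition code_vanishing C A : {vspace {ffun I -> L}} :=
  (C :&: \bigcap_(i in A) lker (linfun (coordinate i)))%VS.

Lemma mem_code_vanishing C A (c : {ffun I -> L}) :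
  reflect (c \in C /\ forall i, i \in A -> c i = 0) (c \in code_vanishing C A).
Proof.
rewrite memv_cap !memvE; apply: (iffP andP) => -[cC cA]; split=> //.
  move=> i iA; move/subv_bigcapP/(_ i iA): cA.
  by rewrite -memvE memv_ker lfunE => /eqP.
apply/subv_bigcapP => i iA.
by rewrite -memvE memv_ker lfunE /= /coordinate cA.
Qed.

Definition code_rank C A : nat :=
  (\dim C - \dim (code_vanishing C A))%N.

Definition nondegenerate C : Prop :=
  forall i, exists2 c, c \in C & coordinate i c != 0.

Definition faithful C : Prop :=
  forall i (x : L), exists2 c, c \in C & coordinate i c = x.

End AdditiveCodes.

Definition hypergraphic (F : fieldType) (L : fieldExtType F) (H : hypergraph)
    (C : {vspace {ffun edge H -> L}}) : Prop :=
  nondegenerate C /\ forall A : {set edge H}, code_rank C A = edge_rank A.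

Definition edge_ordering (H : hypergraph) (o : edge H -> seq (vertex H)) : Prop :=
  forall e, uniq (o e) /\ o e =i inc e.

Section HypergraphicCode.
Variables (F : fieldType) (L : fieldExtType F) (h : nat).
Variables (H : hypergraph) (o : edge H -> seq (vertex H)).
Variable iota : {linear 'rV[F]_h -> L}.

(* With o e = [:: v_1; ...; v_(h+1)], the row (a(v_j) - a(v_1))_{2 <= j <= h+1};
   the default value 0 of the sequence lookup is not reached. *)
Definition edge_differences (a : {ffun vertex H -> F^o}) (e : edge H)
    : 'rV[F]_h :=
  let s : seq F := map a (o e) in \row_(j < h) (s`_j.+1 - s`_0).

Definition Phi (a : {ffun vertex H -> F^o}) : {ffun edge H -> L} :=
  [ffun e => iota (edge_differences a e)].

Fact Phi_is_linear : linear Phi.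
Proof.
have mapD (k : F) (a b : {ffun vertex H -> F^o}) e i :
    (map (k *: a + b) (o e) : seq F)`_i =
    k * (map a (o e) : seq F)`_i + (map b (o e) : seq F)`_i.
  elim: (o e) i => [|v s IHs] [|i] //=; rewrite ?mulr0 ?addr0 //.
  by rewrite !ffunE.
move=> k a b; apply/ffunP => e; rewrite !ffunE -linearP; congr (iota _).
by apply/rowP=> j; rewrite !mxE !mapD mulrBr opprD addrACA.
Qed.

HB.instance Definition _ := GRing.isLinear.Build F _ _ _ Phi Phi_is_linear.

Definition hypergraphic_code : {vspace {ffun edge H -> L}} := limg (linfun Phi).

Lemma hypergraphic_codeP c :
  reflect (exists a, c = Phi a) (c \in hypergraphic_code).
Proof.
apply: (iffP memv_imgP) => [[a _ ->] | [a ->]]; exists a; rewrite ?lfunE //.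
exact: memvf.
Qed.

End HypergraphicCode.

(* Main.v *)
(** The vectors [a] whose codeword vanishes on [A] are exactly those constant on
    every component of [(V, A)], a space of dimension [kappa A].  Hence [C(A)] is
    the image of this space under [Phi], whose kernel is the case [A = E], and
    rank-nullity gives [dim C = N - kappa H] and [dim C(A) = kappa A - kappa H]. *)

Require Import Defs.
From HB Require Import structures.
From mathcomp Require Import all_boot all_order all_algebra all_field.

Set Implicit Arguments.
Unset Strict Implicit.
Unset Printing Implicit Defensive.

Import GRing.Theory.
Local Open Scope ring_scope.

Lemma dim_ffun_regular (F : fieldType) (T : finType) :
  \dim {: {ffun T -> F^o}} = #|T|.
Proof. by rewrite dimvf /dim /= muln1. Qed.

Section ComponentwiseConstant.
Variables (F : fieldType) (H : hypergraph) (A : {set edge H}).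

(** A component is encoded by its canonical root, the representative that [n_comp] counts, so that
    its cardinality is [kappa A] by unfolding. *)
Definition component : finType := {v : vertex H | v \in fingraph.roots (adj A)}.

Definition component_of (v : vertex H) : component :=
  Sub (fingraph.root (adj A) v) (roots_root (@adj_connect_sym H A) v).

Lemma card_component : #|component| = kappa A.
Proof. by rewrite card_sig; apply: eq_card => v; rewrite !inE andbT. Qed.

Lemma component_ofK (c : component) : component_of (val c) = c.
Proof. by apply: val_inj; apply/eqP; apply: (valP c). Qed.

Definition pullback (b : {ffun component -> F^o}) : {ffun vertex H -> F^o} :=
  [ffun v => b (component_of v)].

Fact pullback_is_linear : linear pullback.
Proof. by move=> k a b; apply/ffunP => v; rewrite !ffunE. Qed.

HB.instance Definition _ :=
  GRing.isLinear.Build F _ _ _ pullback pullback_is_linear.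

Definition componentwise_constant : {vspace {ffun vertex H -> F^o}} :=
  limg (linfun pullback).

(** [pullback] is injective: each component is the image of its own root under [component_of], so
    evaluating the pullback at the roots recovers the original function. *)
Lemma dim_componentwise_constant : \dim componentwise_constant = kappa A.
Proof.
rewrite limg_dim_eq ?dim_ffun_regular ?card_component //.
apply/eqP; rewrite capfv -subv0; apply/subvP => b.
rewrite memv_ker memv0 lfunE => /eqP/ffunP b0.
apply/eqP/ffunP => c; rewrite -(component_ofK c).
by have := b0 (val c); rewrite !ffunE.
Qed.

(** This turns the global condition into one on single edges: two vertices of an edge in [A] share a
    root, and conversely equality on edges spreads along walks. *)
Lemma componentwise_constantP (a : {ffun vertex H -> F^o}) :
  reflect (forall e, e \in A -> {in inc e &, forall u v, a u = a v})
          (a \in componentwise_constant).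
Proof.
apply: (iffP memv_imgP) => [[b _ ->] e eA u v ue ve | a_const].
  rewrite lfunE /= !ffunE; congr (b _); apply: val_inj.
  apply/fingraph.rootP; first exact: adj_connect_sym.
  by apply/connect1/existsP; exists e; rewrite eA ue.
exists [ffun c => a (val c)]; first exact: memvf.
apply/ffunP => v; rewrite lfunE /= !ffunE.
(* Follow a path from [v] to its root; each step lies in an edge of [A], so the value of [a] does
   not change. *)
have /connectP[p] := connect_root (adj A) v.
rewrite [sval _]SubK => pth ->; elim: p v pth => //= w p IHp v /andP[/existsP[e]].
by case/and3P=> eA ve we /IHp <-; apply: a_const ve we.
Qed.

End ComponentwiseConstant.

Section Code.
Variables (F : fieldType) (h : nat) (H : hypergraph).
Variables (L : fieldExtType F) (o : edge H -> seq (vertex H)).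
Variable iota : {linear 'rV[F]_h -> L}.
Hypothesis H_uniform : uniform h.+1 H.
Hypothesis o_ordering : edge_ordering o.

Lemma size_ordering e : size (o e) = h.+1.
Proof.
have [o_uniq oE] := o_ordering e.
by rewrite -(H_uniform e) -(eq_card oE) (card_uniqP o_uniq).
Qed.

(** Every entry compares a vertex with the first one [v0], so the row vanishes exactly when all
    values on the edge equal [a v0]. Uniformity makes the row reach every vertex of the edge. *)
Lemma edge_differences_eq0P (a : {ffun vertex H -> F^o}) e :
  edge_differences h o a e = 0 <-> {in inc e &, forall u v, a u = a v}.
Proof.
have [_ oE] := o_ordering e; have := size_ordering e.
rewrite /edge_differences; case: (o e) oE => // v0 s oE [sz_s]; split.
  move=> /rowP d0.
  have a_v0 w : w \in inc e -> a w = a v0.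
    rewrite -oE inE => /predU1P[-> // | /(nthP v0)[i lt_i <-]].
    rewrite sz_s in lt_i; have /eqP := d0 (Ordinal lt_i).
    by rewrite !mxE /= (nth_map v0) ?sz_s // subr_eq0 => /eqP.
  by move=> u v /a_v0 -> /a_v0 ->.
move=> a_const; apply/rowP => j; rewrite !mxE /= (nth_map v0) ?sz_s //.
by apply/eqP; rewrite subr_eq0; apply/eqP/a_const;
  rewrite -oE inE ?eqxx ?mem_nth ?orbT ?sz_s.
Qed.

(** The vertices of an edge are distinct, so values on them can be prescribed independently. *)
Lemma edge_differences_surj e (y : 'rV[F]_h) :
  exists a : {ffun vertex H -> F^o}, edge_differences h o a e = y.
Proof.
have [o_uniq _] := o_ordering e; have := size_ordering e.
rewrite /edge_differences; case: (o e) o_uniq => // v0 s o_uniq [sz_s].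
(* The first vertex gets 0 and the others the entries of [y]. A vertex outside the edge has index
   [h.+1], past the end of [t], and gets the default 0. *)
pose t : seq F := 0 :: [seq y 0 j | j <- enum 'I_h].
exists [ffun v => t`_(index v (v0 :: s))].
have a_nth i : (i < h.+1)%N ->
    ([seq [ffun v => t`_(index v (v0 :: s)) : F^o] v | v <- v0 :: s] : seq F)`_i
    = t`_i.
  move=> lt_i; have lt_sz : (i < size (v0 :: s))%N by rewrite /= sz_s.
  by rewrite (nth_map v0) // ffunE index_uniq.
apply/rowP => j; rewrite mxE !a_nth //; last exact: ltn_ord.
by rewrite /= subr0 (nth_map j) ?size_enum_ord // nth_ord_enum.
Qed.

Hypothesis iota_inj : injective iota.

Lemma Phi_eq0P a e :
  Phi o iota a e = 0 <-> {in inc e &, forall u v, a u = a v}.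
Proof.
rewrite /Phi ffunE; split=> [d0 | /edge_differences_eq0P ->]; last exact: linear0.
by apply/edge_differences_eq0P/iota_inj; rewrite linear0.
Qed.

Lemma code_vanishingE A :
  code_vanishing (hypergraphic_code o iota) A
    = (linfun (Phi o iota) @: componentwise_constant F A)%VS.
Proof.
apply/vspaceP => c; apply/mem_code_vanishing/memv_imgP.
  move=> [/hypergraphic_codeP[a ->] a0]; exists a; last by rewrite lfunE.
  by apply/componentwise_constantP => e /a0/Phi_eq0P.
move=> [a /componentwise_constantP aK ->]; rewrite lfunE; split.
  by apply/hypergraphic_codeP; exists a.
by move=> e /aK/Phi_eq0P.
Qed.

Lemma lker_Phi : lker (linfun (Phi o iota)) = componentwise_constant F [set: edge H].
Proof.
apply/vspaceP => a; rewrite memv_ker lfunE; apply/eqP/componentwise_constantP.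
  by move=> /ffunP a0 e _; apply/Phi_eq0P; rewrite a0 ffunE.
by move=> a_const; apply/ffunP => e; rewrite [RHS]ffunE; apply/Phi_eq0P/a_const.
Qed.

(** The additive form of rank-nullity, here and in [dim_code_vanishing], avoids truncated
    subtraction and lets [code_rankE] cancel the common term. *)
Lemma dim_code :
  (kappa [set: edge H] + \dim (hypergraphic_code o iota))%N = #|vertex H|.
Proof.
rewrite -(dim_ffun_regular F) -(limg_ker_dim (linfun (Phi o iota)) fullv).
by rewrite capfv lker_Phi dim_componentwise_constant.
Qed.

Lemma dim_code_vanishing A :
  (kappa [set: edge H]
     + \dim (code_vanishing (hypergraphic_code o iota) A))%N = kappa A.
Proof.
rewrite code_vanishingE -[RHS](dim_componentwise_constant F).
rewrite -(limg_ker_dim (linfun (Phi o iota)) (componentwise_constant F A)).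
rewrite lker_Phi (_ : _ :&: _ = componentwise_constant F [set: edge H])%VS.
  by rewrite dim_componentwise_constant.
(* The whole kernel of [Phi] lies in the restricted domain, since constancy on all edges implies
   constancy on those of [A]. *)
apply/capv_idPr/subvP => a /componentwise_constantP a_const.
by apply/componentwise_constantP => e _; apply: a_const.
Qed.

Lemma code_rankE A : code_rank (hypergraphic_code o iota) A = edge_rank A.
Proof.
by rewrite /code_rank /edge_rank -dim_code -(dim_code_vanishing A) subnDl.
Qed.

End Code.

Theorem theorem4p11 (F : finFieldType) (r : nat) (r_ge2 : (2 <= r)%N)
    (H : hypergraph) (H_uniform : uniform r H)
    (L : fieldExtType F) (dim_L : \dim {: L} = r.-1)
    (o : edge H -> seq (vertex H)) (o_ordering : edge_ordering o)
    (iota : {linear 'rV[F]_r.-1 -> L}) (iota_bij : bijective iota) :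
  (forall A : {set edge H},
     code_rank (hypergraphic_code o iota) A = edge_rank A) /\
  faithful (hypergraphic_code o iota) /\
  hypergraphic (hypergraphic_code o iota) /\
  \dim (hypergraphic_code o iota)
    = (#|vertex H| - kappa [set: edge H])%N.
Proof.
case: r r_ge2 H_uniform dim_L iota iota_bij => // h _ /= H_uniform _ iota iota_bij.
have iota_inj := bij_inj iota_bij.
have rankE := code_rankE H_uniform o_ordering iota_inj.
have code_faithful : faithful (hypergraphic_code o iota).
  move=> e x; have [g _ gK] := iota_bij.
  have [a da] := edge_differences_surj H_uniform o_ordering e (g x).
  exists (Phi o iota a); first by apply/hypergraphic_codeP; exists a.
  by rewrite /coordinate ffunE da gK.
do !split=> //.
  (* Surjectivity of a coordinate yields a codeword with value 1 there, which is nonzero. *)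
  by move=> e; have [c cC ce] := code_faithful e 1; exists c; rewrite ?ce ?oner_eq0.
by rewrite -(dim_code H_uniform o_ordering iota_inj) addKn.
Qed.
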